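(* There is an algorithm which, given $n$ and the list of vectors $(x_1,z_1),\dots,(x_M,z_M)\in\{0,1\}^{2n}$ labelling the Pauli strings with nonzero coefficient in the Pauli expansion $C=\sum_{i=1}^M c_{(x_i,z_i)}P_{(x_i,z_i)}$ of a symmetric matrix $C\in\mathbb{R}^{2^n\times2^n}$, outputs a set of generators of the diagonal group of $C$ (i.e. of the nontrivial diagonal Pauli strings $\dot{\mathcal{D}}_C$) in time $\mathrm{poly}(M,n)$.
   Context: For $(x,z)\in\{0,1\}^{2n}$ let $P_{(x,z)}=\bigotimes_{j=1}^n i^{x_jz_j}X^{x_j}Z^{z_j}$ be the Pauli string, where $X,Z$ are the $2\times 2$ Pauli matrices. For $A\subseteq[n]=\{1,\dots,n\}$ let $Z_A=P_{(0,z_A)}$, where $z_A$ is the indicator vector of $A$ (so $Z_\varnothing=I$). Modulo phases, Pauli strings under multiplication form a group isomorphic to $(\mathbb{Z}_2^{n}\times\mathbb{Z}_2^n,+)$ via $P_{(x,z)}\mapsto(x,z)$. Diagonal group: $\mathcal{G}_C$ is the group generated under multiplication by the Pauli strings with nonzero coefficient in the expansion of $C$, and $\mathcal{D}_C$ is the set of strings $Z_A$ that lie, up to sign, in $\mathcal{G}_C$. Equivalently, $Z_A\in\mathcal{D}_C$ iff $(0,z_A)$ lies in the $\mathbb{F}_2$-linear span of the vectors $(x_i,z_i)$. Set $\dot{\mathcal{D}}_C=\mathcal{D}_C\setminus\{I\}$. Generators are understood up to sign, i.e. as a set of vectors $(0,z)$ whose $\mathbb{F}_2$-span is $\{(0,z_A):Z_A\in\mathcal{D}_C\}$.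 *)

(* Defs.v *)
From HB Require Import structures.
From mathcomp Require Import all_boot all_order all_algebra.
From mathcomp Require Import reals complex mxtens.

Set Implicit Arguments.
Unset Strict Implicit.
Unset Printing Implicit Defensive.

Import GRing.Theory Num.Theory.
Local Open Scope ring_scope.
Local Open Scope complex_scope.

(** * Deterministic multi-tape Turing machines *)

Inductive symbol := Blank | Bit of bool | Sep.

Inductive direction := MoveLeft | Stay | MoveRight.

(** [Tape l a r] is a two-way infinite tape scanning [a]; [l] lists the cells
    to the left of the head, nearest first, and [r] those to its right.  All
    cells not listed are blank. *)
Record tape := Tape {
  tape_left : seq symbol;
  tape_head : symbol;
  tape_right : seq symbol
}.

Definition move_tape (t : tape) (d : direction) : tape :=
  let: Tape l a r := t in
  match d with
  | MoveLeft => Tape (behead l) (head Blank l) (a :: r)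
  | Stay => t
  | MoveRight => Tape (a :: l) (head Blank r) (behead r)
  end.

Definition write_tape (t : tape) (a : symbol) : tape :=
  Tape (tape_left t) a (tape_right t).

(** [tm_trans q a] is [None] when the machine halts in state [q] scanning the
    symbols [a]; otherwise it gives the next state and, for each tape, the
    symbol to write followed by the head movement. *)
Record turing_machine := TuringMachine {
  tm_state : finType;
  tm_start : tm_state;
  tm_work_tapes : nat;
  tm_trans : tm_state -> (tm_work_tapes.+1).-tuple symbol ->
             option (tm_state * (tm_work_tapes.+1).-tuple (symbol * direction))
}.

Definition config (T : turing_machine) : Type :=
  (tm_state T * (tm_work_tapes T).+1.-tuple tape)%type.

Definition tm_step (T : turing_machine) (c : config T) : option (config T) :=
  let: (q, ts) := c in
  if @tm_trans T q [tuple tape_head (tnth ts i) | i < (tm_work_tapes T).+1]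
    is Some (q', acts)
  then Some (q', [tuple (let: (a, d) := tnth acts i in
                         move_tape (write_tape (tnth ts i) a) d)
                 | i < (tm_work_tapes T).+1])
  else None.

Fixpoint tm_run (T : turing_machine) (t : nat) (c : config T) : config T :=
  if t is t'.+1 then
    if tm_step c is Some c' then tm_run t' c' else c
  else c.

Definition tape_of_word (w : seq symbol) : tape :=
  Tape [::] (head Blank w) (behead w).

Fixpoint upto_blank (w : seq symbol) : seq symbol :=
  match w with
  | [::] | Blank :: _ => [::]
  | a :: w' => a :: upto_blank w'
  end.

Definition word_of_tape (t : tape) : seq symbol :=
  upto_blank (tape_head t :: tape_right t).

(** Tape [ord0] carries both the input and the output. *)
Definition tm_init (T : turing_machine) (w : seq symbol) : config T :=
  (tm_start T, [tuple (if i == ord0 then tape_of_word w else tape_of_word [::])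
               | i < (tm_work_tapes T).+1]).

Definition outputs_within (T : turing_machine) (w : seq symbol) (t : nat)
    (out : seq symbol) : Prop :=
  let c := tm_run t (tm_init T w) in
  tm_step c = None /\ word_of_tape (tnth c.2 ord0) = out.

(** * Pauli strings *)

Notation label n := ('rV['F_2]_n * 'rV['F_2]_n)%type.

Section Pauli.
Variable R : realType.

Definition pauliX : 'M[R[i]]_2 := \matrix_(i, j) (i != j)%:R.
Definition pauliZ : 'M[R[i]]_2 := \matrix_(i, j) ((i == j)%:R * (-1) ^+ i).

(** [tensor A] is [A 0 *t A 1 *t ... *t A (n - 1)]. *)
Fixpoint tensor n : ('I_n -> 'M[R[i]]_2) -> 'M[R[i]]_(2 ^ n) :=
  match n with
  | 0 => fun _ => 1%:M
  | n'.+1 => fun A =>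
      castmx (esym (expnS 2 n'), esym (expnS 2 n'))
        (tensmx (A ord0) (tensor (fun j => A (lift ord0 j))))
  end.

(** The exponents are the representatives in {0, 1}, so that [x_j * z_j] is a
    product of natural numbers: it is not reduced modulo 2. *)
Definition pauli n (v : label n) : 'M[R[i]]_(2 ^ n) :=
  tensor (fun j => let x : nat := v.1 0 j in let z : nat := v.2 0 j in
    ('i%C ^+ (x * z)) *: (pauliX ^+ x *m pauliZ ^+ z)).

Definition diag_label n (A : {set 'I_n}) : label n :=
  (0, \row_j (j \in A)%:R).

Definition pauli_expansion n (C : 'M[R]_(2 ^ n)) (c : label n -> R[i]) : Prop :=
  map_mx (real_complex R) C = \sum_(v : label n) c v *: pauli v.

(** The group generated by a set [S] of invertible matrices. *)
Inductive generated_group m (S : 'M[R[i]]_m -> Prop) : 'M[R[i]]_m -> Prop :=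
  | gen_mem M of S M : generated_group S M
  | gen_one : generated_group S 1%:M
  | gen_mul M N of generated_group S M & generated_group S N :
      generated_group S (M *m N)
  | gen_inv M of generated_group S M : generated_group S (invmx M).

(** Here and below [c] is the coefficient family of the expansion of [C]. *)
Definition pauli_group_of n (c : label n -> R[i]) : 'M[R[i]]_(2 ^ n) -> Prop :=
  generated_group (fun M => exists2 v : label n, c v != 0 & M = pauli v).

Definition diagonal_group n (c : label n -> R[i]) (A : {set 'I_n}) : Prop :=
  let ZA := pauli (diag_label A) in
  pauli_group_of c ZA \/ pauli_group_of c (- ZA).

Definition nontrivial_diagonal n (c : label n -> R[i]) (A : {set 'I_n}) : Prop :=
  diagonal_group c A /\ pauli (diag_label A) <> 1%:M.

(** Generators up to sign, chosen among the nontrivial diagonal strings. *)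
Definition generates_diagonal n (c : label n -> R[i]) (gens : seq (label n)) :
    Prop :=
  (forall g, g \in gens -> exists2 A, nontrivial_diagonal c A & g = diag_label A)
  /\ (forall v : label n, v \in <<gens>>%VS <->
        exists2 A, diagonal_group c A & v = diag_label A).

End Pauli.

(** * Encoding of instances as words *)

Definition encode_vector n (u : 'rV['F_2]_n) : seq symbol :=
  [seq Bit (u 0 j != 0) | j <- enum 'I_n].

Definition encode_labels n (s : seq (label n)) : seq symbol :=
  flatten [seq encode_vector v.1 ++ encode_vector v.2 ++ [:: Sep] | v <- s].

Definition encode_input n (s : seq (label n)) : seq symbol :=
  nseq n (Bit true) ++ Sep :: encode_labels s.

(* Main.v *)
Require Import Defs.
From HB Require Import structures.
From mathcomp Require Import all_boot all_order all_algebra.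
From mathcomp Require Import reals complex mxtens.
From mathcomp Require Import zify.

(** Since [C] is symmetric, only Pauli strings with an even number of Y's occur
    in it (transposition multiplies a string by [-1] to that number, and the
    strings are linearly independent, by orthogonality for the trace).  These
    are real, so every element of the group they generate is, up to sign, the
    real string X^x Z^z of a vector (x, z) in the span of the labels; the
    diagonal group is therefore the subspace x = 0 of that span.

    Gaussian elimination computes it.  For each column j, with p the first
    vector having x_j = 1, replace every v by v + x_j(v) p: this projects the
    span onto its subspace x_j = 0, and sends p itself to 0.  Since column j is
    now zero, it is dropped.  After n columns only the z parts remain; the
    nonzero ones are output with n zeros in front.

    The algorithm runs on five stacks, of which the first is both input and
    output.  A tape holds a stack with its top under the head and the rest to
    the right. *)

Set Implicit Arguments.
Unset Strict Implicit.
Unset Printing Implicit Defensive.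

Import GRing.Theory Num.Theory.

(** * Stack machines as Turing machines *)

Inductive stack_op := Keep | Pop | Push of option bool.

Definition apply_op (op : stack_op) (s : seq (option bool)) :=
  match op with Keep => s | Pop => behead s | Push a => a :: s end.

(** [None] stands for the separator. No stack entry becomes [Blank], so the first blank of a tape
    marks the bottom of its stack. *)
Definition tape_symbol (a : option bool) : symbol :=
  if a is Some b then Bit b else Sep.

Definition stack_symbol (a : symbol) : option (option bool) :=
  match a with Blank => None | Bit b => Some (Some b) | Sep => Some None end.

Section StackMachine.
Variables (Q : finType) (q0 : Q) (k : nat).
Variable delta : Q -> seq (option (option bool)) -> option (Q * seq stack_op).

Definition stack_config := (Q * seq (seq (option bool)))%type.

Definition stack_step (c : stack_config) : option stack_config :=
  if delta c.1 (mkseq (fun i => ohead (nth [::] c.2 i)) k.+1) is Some (q, ops)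
  then Some (q, mkseq (fun i => apply_op (nth Keep ops i) (nth [::] c.2 i)) k.+1)
  else None.

(** [reaches_refl] holds for every [t], which makes [t] an upper bound on the number of steps rather
    than the exact number. *)
Inductive reaches : nat -> stack_config -> stack_config -> Prop :=
| reaches_refl t c : reaches t c c
| reaches_step t c1 c2 c3 :
    stack_step c1 = Some c2 -> reaches t c2 c3 -> reaches t.+1 c1 c3.

Lemma reaches_weaken s t c1 c2 : s <= t -> reaches s c1 c2 -> reaches t c1 c2.
Proof.
move=> le_st r; elim: r t le_st => [*|{}s {}c1 c3 c4 st _ IH [//|t] le_st].
  exact: reaches_refl.
by apply: reaches_step st _; apply: IH.
Qed.

Lemma reaches_trans s t c1 c2 c3 :
  reaches s c1 c2 -> reaches t c2 c3 -> reaches (s + t) c1 c3.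
Proof.
elim=> [s0 c|s0 d1 d2 d3 st _ IH] r; first exact: reaches_weaken (leq_addl _ _) r.
by apply: reaches_step st _; apply: IH.
Qed.

(* A state [inr (q, p)] is entered by a move after which the symbols [p] are
   still to be written; pushing thus takes two steps. *)
Definition stack_tm_state := (Q + Q * (k.+1).-tuple (option (option bool)))%type.

Definition head_move (op : stack_op) : direction :=
  match op with Keep => Stay | Pop => MoveRight | Push _ => MoveLeft end.

Definition pushed (op : stack_op) : option (option bool) :=
  if op is Push a then Some a else None.

Definition stack_trans (q : stack_tm_state) (hs : (k.+1).-tuple symbol) :
    option (stack_tm_state * (k.+1).-tuple (symbol * direction)) :=
  match q with
  | inl q =>
      if delta q (map stack_symbol hs) is Some (q', ops)
      then Some (inr (q', [tuple pushed (nth Keep ops i) | i < k.+1]),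
                 [tuple (tnth hs i, head_move (nth Keep ops i)) | i < k.+1])
      else None
  | inr (q', p) =>
      Some (inl q', [tuple (oapp tape_symbol (tnth hs i) (tnth p i), Stay)
                    | i < k.+1])
  end.

Definition stack_tm : turing_machine :=
  @TuringMachine stack_tm_state (inl q0) k stack_trans.

(** Comparing cells through [nth Blank] ignores explicit trailing blanks. The cells left of the head
    are free: popped symbols stay there until a push overwrites them. *)
Definition represents (t : tape) (s : seq (option bool)) : Prop :=
  nth Blank (tape_head t :: tape_right t) =1 nth Blank (map tape_symbol s).

Definition tapes_represent (ts : (k.+1).-tuple tape)
    (ss : seq (seq (option bool))) : Prop :=
  forall i : 'I_k.+1, represents (tnth ts i) (nth [::] ss i).

Lemma stack_symbol_head t s : represents t s -> stack_symbol (tape_head t) = ohead s.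
Proof. by move=> /(_ 0) /= ->; case: s => [|[b|] s]. Qed.

Lemma represents_op t s op : represents t s ->
  let t' := move_tape (write_tape t (tape_head t)) (head_move op) in
  represents (write_tape t' (oapp tape_symbol (tape_head t') (pushed op)))
             (apply_op op s).
Proof.
case: t => l a r rep; case: op => [||b] /= i; first exact: rep.
- have -> : nth Blank [seq tape_symbol j | j <- behead s] i = nth Blank (a :: r) i.+1.
    by rewrite (rep i.+1); case: s {rep} => //=; rewrite nth_nil.
  by case: r {rep} => //; case: i => //= i; rewrite !nth_nil.
- by case: i.
Qed.

Lemma tops_represent ts ss : tapes_represent ts ss ->
  map stack_symbol [tuple tape_head (tnth ts i) | i < k.+1] =
  mkseq (fun i => ohead (nth [::] ss i)) k.+1.
Proof.
move=> rep; apply: (@eq_from_nth _ None); first by rewrite size_mkseq size_map size_tuple.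
move=> i; rewrite size_map size_tuple => lti.
rewrite nth_mkseq // (nth_map Blank) ?size_tuple //.
have -> : i = Ordinal lti by [].
by rewrite -tnth_nth tnth_mktuple; apply: stack_symbol_head.
Qed.

Lemma simulate_step c1 c2 (ts : (k.+1).-tuple tape) :
  stack_step c1 = Some c2 -> tapes_represent ts c1.2 ->
  exists2 ts' : (k.+1).-tuple tape, tapes_represent ts' c2.2 &
    forall m, @tm_run stack_tm m.+2 (inl c1.1, ts) = @tm_run stack_tm m (inl c2.1, ts').
Proof.
case: c1 => q ss /= st rep.
move: st; rewrite /stack_step /= -(tops_represent rep).
case E: (delta _ _) => [[q' ops]|//] [<-] /=.
set ts1 := [tuple move_tape (write_tape (tnth ts i) (tape_head (tnth ts i)))
                            (head_move (nth Keep ops i)) | i < k.+1].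
set ts2 := [tuple write_tape (tnth ts1 i)
    (oapp tape_symbol (tape_head (tnth ts1 i)) (pushed (nth Keep ops i))) | i < k.+1].
exists ts2.
  move=> i; rewrite nth_mkseq // !tnth_mktuple; exact: represents_op.
move=> m /=; congr (tm_run _ (_, _)).
apply: eq_from_tnth => i; rewrite !tnth_mktuple /=.
by case: (head_move _); case: (tnth ts i).

Qed.

(** Each stack step costs two machine steps. Since [t] is only a bound, the exact number [s] of
    machine steps is existential. *)
Lemma simulate_reaches t c1 c2 (ts : (k.+1).-tuple tape) :
  reaches t c1 c2 -> tapes_represent ts c1.2 ->
  exists2 ts' : (k.+1).-tuple tape, tapes_represent ts' c2.2 &
    exists2 s, s <= t.*2 &
    forall m, @tm_run stack_tm (s + m) (inl c1.1, ts) = @tm_run stack_tm m (inl c2.1, ts').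
Proof.
move=> r; elim: r ts => [{}t c|{}t d1 d2 d3 st _ IH] ts rep.
  by exists ts => //; exists 0.
have [ts1 rep1 E1] := simulate_step st rep.
have [ts2 rep2 [s les E2]] := IH _ rep1.
exists ts2 => //; exists s.+2; first by rewrite doubleS !ltnS.
by move=> m; rewrite !addSn E1 E2.
Qed.

Lemma represents_word s : represents (tape_of_word (map tape_symbol s)) s.
Proof. by case: s => [|a s] // [|[]]. Qed.

Lemma word_of_represents t s : represents t s -> word_of_tape t = map tape_symbol s.
Proof.
rewrite /word_of_tape; case: t => l a r; rewrite /represents [tape_head _]/= [tape_right _]/=.
elim: s a r => [|b s IH] a r rep.
  by have /= -> := rep 0.
have /= := rep 0 => ->.
have -> : upto_blank r = map tape_symbol s.
  case: r rep => [|a' r] rep.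
    by case: s rep {IH} => // c s /(_ 1) /=; case: c.
  by rewrite -(IH a' r) // => i; apply: (rep i.+1).
by case: b {rep}.
Qed.

Lemma stack_tm_outputs t b w q ss :
  reaches t (q0, mkseq (fun i => if i == 0 then w else [::]) k.+1) (q, ss) ->
  stack_step (q, ss) = None -> t.*2 <= b ->
  outputs_within stack_tm (map tape_symbol w) b (map tape_symbol (nth [::] ss 0)).
Proof.
move=> r halt leb; rewrite /outputs_within /tm_init.
set ts := [tuple _ | _ < _].
have rep : tapes_represent ts (mkseq (fun i => if i == 0 then w else [::]) k.+1).
  move=> i; rewrite nth_mkseq // tnth_mktuple.
  have -> : (i == ord0) = (i == 0 :> nat) by [].
  by case: ifP => _; [apply: represents_word | apply: (represents_word [::])].
have [ts' rep' [s les E]] := simulate_reaches r rep.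
have stop : @tm_step stack_tm (inl q, ts') = None.
  by move: halt; rewrite /stack_step /= -(tops_represent rep'); case: (delta _ _) => // [[]].
(* The time left after [s] steps is harmless, because a halted configuration no longer changes. *)
rewrite -(subnKC (leq_trans les leb)) E.
have -> m : @tm_run stack_tm m (inl q, ts') = (inl q, ts') by case: m => // m; rewrite /tm_run stop.
by split=> //; apply: word_of_represents; apply: (rep' ord0).
Qed.

End StackMachine.

(** * The elimination machine *)

Inductive phase :=
  | LoadCount | NextColumn | NextVector | CopyVector | AddPivot | RestorePivot
  | DropPivot | RewindColumn | ScanTail of bool | DropTail | PadZeros | EmitTail
  | RewindOutput.

(** A numbering that makes [phase] a finite type, as the states of a Turing machine must be. *)
Definition phase_code (q : phase) : nat :=
  match q with
  | LoadCount => 0 | NextColumn => 1 | NextVector => 2 | CopyVector => 3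
  | AddPivot => 4 | RestorePivot => 5 | DropPivot => 6 | RewindColumn => 7
  | ScanTail false => 8 | ScanTail true => 9 | DropTail => 10 | PadZeros => 11
  | EmitTail => 12 | RewindOutput => 13
  end.

Definition phase_decode (i : 'I_14) : option phase :=
  nth None (map Some [:: LoadCount; NextColumn; NextVector; CopyVector; AddPivot;
    RestorePivot; DropPivot; RewindColumn; ScanTail false; ScanTail true;
    DropTail; PadZeros; EmitTail; RewindOutput]) i.

Lemma phase_codeK : pcancel (fun q => inord (phase_code q)) phase_decode.
Proof. by case=> [||||||||[]||||]; rewrite /phase_decode inordK. Qed.

HB.instance Definition _ := Finite.copy phase (pcan_type phase_codeK).

(* The stacks are: the vectors still to be processed; those already processed,
   reversed; the pivot; the part of the pivot already used, reversed; and the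
   number of columns left, in unary.  While [AddPivot] runs with no pivot it
   takes the current vector as its own pivot. *)
Definition transition (q : phase) (tops : seq (option (option bool))) :
    option (phase * seq stack_op) :=
  match tops with
  | [:: a; b; p; r; k] =>
    match q, a, b, p, r, k with
    | LoadCount, Some (Some x), _, _, _, _ =>
        Some (LoadCount, [:: Pop; Keep; Keep; Keep; Push (Some x)])
    | LoadCount, Some None, _, _, _, _ =>
        Some (NextColumn, [:: Pop])
    | NextColumn, _, _, _, _, Some _ =>
        Some (NextVector, [:: Keep; Keep; Keep; Keep; Pop])
    | NextColumn, _, _, _, _, None => Some (ScanTail false, [::])
    | NextVector, Some (Some x), _, _, _, _ =>
        Some (if x then AddPivot else CopyVector, [:: Pop])
    | NextVector, None, _, _, _, _ => Some (DropPivot, [::])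
    | CopyVector, Some (Some x), _, _, _, _ =>
        Some (CopyVector, [:: Pop; Push (Some x)])
    | CopyVector, Some None, _, _, _, _ => Some (NextVector, [:: Pop; Push None])
    | AddPivot, Some (Some x), _, _, _, _ =>
        let y := if p is Some (Some y) then y else x in
        Some (AddPivot, [:: Pop; Push (Some (x (+) y)); Pop; Push (Some y)])
    | AddPivot, Some None, _, _, _, _ => Some (RestorePivot, [:: Pop; Push None])
    | RestorePivot, _, _, _, Some x, _ =>
        Some (RestorePivot, [:: Keep; Keep; Push x; Pop])
    | RestorePivot, _, _, _, None, _ => Some (NextVector, [::])
    | DropPivot, _, _, Some _, _, _ => Some (DropPivot, [:: Keep; Keep; Pop])
    | DropPivot, _, _, None, _, _ => Some (RewindColumn, [::])
    | RewindColumn, _, Some x, _, _, _ => Some (RewindColumn, [:: Push x; Pop])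
    | RewindColumn, _, None, _, _, _ => Some (NextColumn, [::])
    | ScanTail f, Some (Some x), _, _, _, _ =>
        Some (ScanTail (f || x), [:: Pop; Keep; Keep; Push (Some x)])
    | ScanTail f, Some None, _, _, _, _ =>
        Some (if f then PadZeros else DropTail, [:: Pop])
    | ScanTail _, None, _, _, _, _ => Some (RewindOutput, [::])
    | DropTail, _, _, _, Some _, _ =>
        Some (DropTail, [:: Keep; Keep; Keep; Pop])
    | DropTail, _, _, _, None, _ => Some (ScanTail false, [::])
    | PadZeros, _, _, _, Some x, _ =>
        Some (PadZeros, [:: Keep; Push (Some false); Push x; Pop])
    | PadZeros, _, _, _, None, _ => Some (EmitTail, [::])
    | EmitTail, _, _, Some x, _, _ => Some (EmitTail, [:: Keep; Push x; Pop])
    | EmitTail, _, _, None, _, _ => Some (ScanTail false, [:: Keep; Push None])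
    | RewindOutput, _, Some x, _, _, _ => Some (RewindOutput, [:: Push x; Pop])
    | _, _, _, _, _, _ => None
    end
  | _ => None
  end.

(** * Runs of the elimination phases *)

Ltac machine_step := eapply reaches_step; [reflexivity | rewrite /mkseq /=].

Notation reach := (reaches 4 transition).

Definition block (w : seq bool) : seq (option bool) := rcons (map Some w) None.
Definition blocks (ws : seq (seq bool)) := flatten (map block ws).

Definition xor_word (u v : seq bool) : seq bool := map (uncurry addb) (zip u v).

(** One column of Gaussian elimination, dropping the leading bit of every word. An empty [p] means
    that no pivot has been found; the first word with leading bit 1 then becomes the pivot and is
    added to itself. *)
Fixpoint eliminate (p : seq bool) (ws : seq (seq bool)) : seq (seq bool) :=
  match ws with
  | (true :: w) :: ws' =>
      let p' := if nilp p then w else p in xor_word w p' :: eliminate p' ws'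
  | w :: ws' => behead w :: eliminate p ws'
  | [::] => [::]
  end.

(** Moving a stack onto another one reverses it, hence [catrev] here and in the later phases. *)
Lemma load_count c a k :
  reach (size c).+1 (LoadCount, [:: map Some c ++ None :: a; [::]; [::]; [::]; k])
    (NextColumn, [:: a; [::]; [::]; [::]; catrev (map Some c) k]).
Proof.
elim: c k => [|x c IH] k; machine_step; last exact: IH.
exact: reaches_refl.
Qed.

Lemma copy_vector w a b p k :
  reach (size w).+1 (CopyVector, [:: block w ++ a; b; p; [::]; k])
    (NextVector, [:: a; catrev (block w) b; p; [::]; k]).
Proof.
elim: w b => [|x w IH] b; machine_step; last exact: IH.
exact: reaches_refl.
Qed.

Lemma add_pivot w p a b r k : size p = size w ->
  reach (size w).+1
    (AddPivot, [:: block w ++ a; b; map Some p; r; k])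
    (RestorePivot, [:: a; catrev (block (xor_word w p)) b; [::];
                       catrev (map Some p) r; k]).
Proof.
elim: w p b r => [|x w IH] [|y p] b r //= eq_size; machine_step.
  exact: reaches_refl.
by apply: IH; case: eq_size.
Qed.

(** With an empty pivot stack the transition uses [y := x], so the current word cancels and its copy
    on the fourth stack becomes the pivot. *)
Lemma add_pivot_self w a b r k :
  reach (size w).+1
    (AddPivot, [:: block w ++ a; b; [::]; r; k])
    (RestorePivot, [:: a; catrev (block (xor_word w w)) b; [::];
                       catrev (map Some w) r; k]).
Proof.
elim: w b r => [|x w IH] b r /=; machine_step.
  exact: reaches_refl.
exact: IH.
Qed.

Lemma restore_pivot r a b p k :
  reach (size r).+1 (RestorePivot, [:: a; b; p; r; k])
    (NextVector, [:: a; b; catrev r p; [::]; k]).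
Proof.
elim: r p => [|x r IH] p; machine_step; last exact: IH.
exact: reaches_refl.
Qed.

Lemma drop_pivot p b k :
  reach (size p).+1 (DropPivot, [:: [::]; b; p; [::]; k])
    (RewindColumn, [:: [::]; b; [::]; [::]; k]).
Proof.
elim: p => [|x p IH]; machine_step; last exact: IH.
exact: reaches_refl.
Qed.

Lemma rewind_column b a k :
  reach (size b).+1 (RewindColumn, [:: a; b; [::]; [::]; k])
    (NextColumn, [:: catrev b a; [::]; [::]; [::]; k]).
Proof.
elim: b a => [|x b IH] a; machine_step; last exact: IH.
exact: reaches_refl.
Qed.

(** A vector costs at most one step for its leading bit, [m.+2] for adding the pivot and [m.+2] for
    restoring it. Length [m.+2] keeps the tails nonempty, so that a pivot cannot be confused with
    the absence of one. *)
Lemma eliminate_vectors m p ws b k :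
  all (fun w => size w == m.+2) ws -> (p == [::]) || (size p == m.+1) ->
  exists2 p', size p' <= m.+1 &
  reach (size ws * (2 * m + 5) + 1)
    (NextVector, [:: blocks ws; b; map Some p; [::]; k])
    (DropPivot, [:: [::]; catrev (blocks (eliminate p ws)) b; map Some p'; [::]; k]).
Proof.
elim: ws p b => [|w ws IH] p b /= => [_ szp|/andP[/eqP szw szws] szp].
  exists p; first by case/orP: szp => /eqP->.
  by machine_step; apply: reaches_refl.
case: w szw => // x w [szw]; rewrite /blocks /=.
case: x => /=.
  set p' := if nilp p then w else p.
  have szp' : size p' = m.+1.
    by rewrite /p'; case/orP: szp => [/eqP-> //|/eqP szp]; rewrite /nilp szp.
  have [|q szq IHq] := IH p' (catrev (block (xor_word w p')) b) szws.
    by rewrite szp' eqxx orbT.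
  exists q => //.
  apply: (@reaches_weaken _ _ _ (1 + ((size w).+1 + ((size p').+1 +
             (size ws * (2 * m + 5) + 1))))); first by rewrite szw szp'; lia.
  machine_step.
  apply: (@reaches_trans _ _ _ _ _ _
    (RestorePivot, [:: blocks ws; catrev (block (xor_word w p')) b; [::];
                       catrev (map Some p') [::]; k])).
    rewrite /p'; case/orP: szp => [/eqP->|/eqP szp].
      exact: add_pivot_self.
    by rewrite /nilp szp; apply: add_pivot; rewrite szp szw.
  apply: reaches_trans.
    rewrite (_ : size p' = size (catrev (map Some p') [::])).
      exact: restore_pivot.
    by rewrite catrevE cats0 size_rev size_map.
  (* The second reversal puts the pivot back in its original order. *)
  rewrite (catrevE (map _ p')) cats0 (catrevE (rev _)) cats0 revK.
  by rewrite catrev_catl.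
have [q szq IHq] := IH p (catrev (block w) b) szws szp.
exists q => //.
apply: (@reaches_weaken _ _ _ (1 + ((size w).+1 + (size ws * (2 * m + 5) + 1)))).
  by rewrite szw; lia.
machine_step.
apply: reaches_trans (copy_vector _ _ _ _ _) _.
by rewrite catrev_catl.
Qed.

Lemma size_blocks m ws :
  all (fun w => size w == m) ws -> size (blocks ws) = size ws * m.+1.
Proof.
elim: ws => //= w ws IH /andP[/eqP szw szws].
by rewrite size_cat size_rcons size_map szw IH.
Qed.

Lemma size_eliminate p ws : size (eliminate p ws) = size ws.
Proof. by elim: ws p => //= [[|[] w] ws IH] p /=; rewrite IH. Qed.

Lemma eliminate_sizes m p ws :
  all (fun w => size w == m.+2) ws -> (p == [::]) || (size p == m.+1) ->
  all (fun w => size w == m.+1) (eliminate p ws).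
Proof.
elim: ws p => //= -[|[] w] ws IH p //= /andP[szw szws] szp; last first.
  by apply/andP; split; [exact: szw | exact: IH].
have szp' : size (if nilp p then w else p) = m.+1.
  case/orP: szp => [/eqP-> /=|/eqP szp]; first by case/eqP: szw.
  by rewrite /nilp szp.
apply/andP; split; last by apply: IH; rewrite // szp' eqxx orbT.
by rewrite size_map size_zip szp'; case/eqP: szw => ->; rewrite minnn.
Qed.

Lemma eliminate_column m ws k :
  all (fun w => size w == m.+2) ws ->
  reach (size ws * (3 * m + 7) + m + 6)
    (NextColumn, [:: blocks ws; [::]; [::]; [::]; Some true :: k])
    (NextColumn, [:: blocks (eliminate [::] ws); [::]; [::]; [::]; k]).
Proof.
(* The summands are: decrementing the column counter, the pass over the vectors, erasing a pivot of
   at most [m.+1] bits, and rewinding [size ws] blocks of [m.+2] symbols. *)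
move=> szws; apply: (@reaches_weaken _ _ _
  (1 + ((size ws * (2 * m + 5) + 1) + (m.+2 + (size ws * m.+2).+1)))).
  by lia.
machine_step.
have [//|p szp r] := @eliminate_vectors m [::] ws [::] k szws.
apply: reaches_trans r _.
apply: (@reaches_trans _ _ _ m.+2).
  apply: (@reaches_weaken _ _ _ (size (map Some p)).+1); first by rewrite size_map.
  exact: drop_pivot.
have -> : size ws * m.+2 = size (catrev (blocks (eliminate [::] ws)) [::]).
  rewrite catrevE cats0 size_rev (@size_blocks m.+1) ?size_eliminate //.
  exact: eliminate_sizes.
rewrite -[in X in reaches _ _ _ _ X](revK (blocks _)) -[rev (rev _)]cats0 -catrevE.
rewrite -[in X in reaches _ _ _ _ X](cats0 (rev _)) -catrevE.
exact: rewind_column.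
Qed.

(** The lengths [n + m.+1] leave at least one bit after the last column, as [eliminate_column]
    requires each time. *)
Lemma eliminate_columns n m ws :
  all (fun w => size w == n + m.+1) ws ->
  reach (n * (size ws * (3 * (n + m) + 7) + n + m + 6))
    (NextColumn, [:: blocks ws; [::]; [::]; [::]; nseq n (Some true)])
    (NextColumn, [:: blocks (iter n (eliminate [::]) ws); [::]; [::]; [::]; [::]]).
Proof.
elim: n ws => [|n IH] ws szws; first exact: reaches_refl.
rewrite iterSr.
have szws' : all (fun w => size w == (n + m).+2) ws.
  by apply: sub_all szws => w /eqP->; rewrite addSn addnS.
apply: reaches_weaken; last first.
  apply: reaches_trans (@eliminate_column (n + m) _ _ szws') (IH _ _).
  by rewrite addnS; apply: eliminate_sizes.
rewrite size_eliminate; nia.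
Qed.

(** * Filtering and output of the remaining tails *)

Lemma scan_tail w f a b r :
  reach (size w).+1 (ScanTail f, [:: block w ++ a; b; [::]; r; [::]])
    (if has id w || f then PadZeros else DropTail,
      [:: a; b; [::]; catrev (map Some w) r; [::]]).
Proof.
elim: w f r => [|x w IH] f r; machine_step; first exact: reaches_refl.
have -> : x || has id w || f = has id w || (f || x) by case: x f (has _ _) => [] [] [].
exact: IH.
Qed.

Lemma drop_tail r a b :
  reach (size r).+1 (DropTail, [:: a; b; [::]; r; [::]])
    (ScanTail false, [:: a; b; [::]; [::]; [::]]).
Proof.
elim: r => [|x r IH]; machine_step; last exact: IH.
exact: reaches_refl.
Qed.

(** The column counter is used up by now. The length of the tail itself supplies the number of
    zeros, since the x and z parts are equally long. *)
Lemma pad_zeros r a b p :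
  reach (size r).+1 (PadZeros, [:: a; b; p; r; [::]])
    (EmitTail, [:: a; nseq (size r) (Some false) ++ b; catrev r p; [::]; [::]]).
Proof.
elim: r b p => [|x r IH] b p; machine_step; first exact: reaches_refl.
have shift n : Some false :: nseq n (Some false) ++ b =
    nseq n (Some false) ++ Some false :: b by elim: n => //= n ->.
by rewrite shift; apply: IH.
Qed.

Lemma emit_tail p a b :
  reach (size p).+1 (EmitTail, [:: a; b; p; [::]; [::]])
    (ScanTail false, [:: a; None :: catrev p b; [::]; [::]; [::]]).
Proof.
elim: p b => [|x p IH] b; machine_step; last exact: IH.
exact: reaches_refl.
Qed.

(** No extra step is counted at the end: the machine halts in [RewindOutput] once the second stack
    is empty. *)
Lemma rewind_output b a :
  reach (size b) (RewindOutput, [:: a; b; [::]; [::]; [::]])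
    (RewindOutput, [:: catrev b a; [::]; [::]; [::]; [::]]).
Proof.
elim: b a => [|x b IH] a; first exact: reaches_refl.
machine_step; exact: IH.
Qed.

Definition pad n (ws : seq (seq bool)) : seq (seq bool) :=
  [seq nseq n false ++ w | w <- ws & has id w].

(** A nonzero tail is scanned, padded and emitted in [n.+1] steps each; a zero tail is only scanned
    and dropped. *)
Lemma filter_tails n ws b :
  all (fun w => size w == n) ws ->
  reach (size ws * (3 * n.+1)).+1
    (ScanTail false, [:: blocks ws; b; [::]; [::]; [::]])
    (RewindOutput, [:: [::]; catrev (blocks (pad n ws)) b; [::]; [::]; [::]]).
Proof.
elim: ws b => [|w ws IH] b /=.
  by move=> _; machine_step; apply: reaches_refl.
case/andP => /eqP szw szws.
have szr : size (catrev (map Some w) [::]) = n.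
  by rewrite catrevE cats0 size_rev size_map.
have r1 := scan_tail w false (blocks ws) b [::].
rewrite szw orbF in r1.
rewrite /pad /=; case: (has id w) r1 => r1.
  have := pad_zeros (catrev (map Some w) [::]) (blocks ws) b [::].
  rewrite szr (catrevE (catrev _ _)) catrevE !cats0 revK => r2.
  have := emit_tail (map Some w) (blocks ws) (nseq n (Some false) ++ b).
  rewrite size_map szw => r3.
  apply: reaches_weaken; last first.
    apply: reaches_trans r1 (reaches_trans r2 (reaches_trans r3 _)).
    have -> : catrev (blocks [seq nseq n false ++ w0 | w0 <- w :: [seq w0 <- ws | has id w0]]) b =
       catrev (blocks (pad n ws)) (None :: catrev (map Some w) (nseq n (Some false) ++ b)).
      rewrite /blocks /= catrev_catl /block -cats1 catrev_catl map_cat catrev_catl map_nseq.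
      by rewrite (catrevE (nseq _ _)) rev_nseq.
    exact: IH.
  lia.
apply: reaches_weaken; last first.
  have := drop_tail (catrev (map Some w) [::]) (blocks ws) b.
  rewrite szr => r2.
  exact: reaches_trans r1 (reaches_trans r2 (IH _ szws)).
lia.
Qed.

(** * Total output and running time of the machine *)

Lemma iter_eliminate_sizes n m ws :
  all (fun w => size w == n + m.+1) ws ->
  all (fun w => size w == m.+1) (iter n (eliminate [::]) ws) /\
  size (iter n (eliminate [::]) ws) = size ws.
Proof.
elim: n ws => [//|n IH] ws szws; rewrite iterSr.
rewrite -(size_eliminate [::] ws); apply: IH; rewrite addnS.
by apply: eliminate_sizes => //; rewrite addSn addnS in szws.
Qed.

Definition diagonal_tm : turing_machine := stack_tm LoadCount 4 transition.

Lemma diagonal_tm_outputs n ws :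
  all (fun w => size w == n + n) ws ->
  outputs_within diagonal_tm
    (map tape_symbol (nseq n (Some true) ++ None :: blocks ws))
    (100 * (size ws + n + 1) ^ 3)
    (map tape_symbol (blocks (pad n (iter n (eliminate [::]) ws)))).
Proof.
move=> szws; set M := size ws; set ws' := iter n _ _.
have [szws' eqM] : all (fun w => size w == n) ws' /\ size ws' = M.
  case: n @ws' szws => [|n] // ws'; exact: iter_eliminate_sizes.
(* For positive [n] the length [n + n] is [n + (n.-1).+1], the form needed by [eliminate_columns];
   for [n = 0] there is no column to process. *)
have column_run : reach (n * (M * (3 * (n + n.-1) + 7) + n + n.-1 + 6))
    (NextColumn, [:: blocks ws; [::]; [::]; [::]; nseq n (Some true)])
    (NextColumn, [:: blocks ws'; [::]; [::]; [::]; [::]]).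
  case: n @ws' szws {szws' eqM} => [|n] ws' szws; first exact: reaches_refl.
  exact: (@eliminate_columns n.+1 n ws).
have load : reach n.+1
    (LoadCount, [:: nseq n (Some true) ++ None :: blocks ws; [::]; [::]; [::]; [::]])
    (NextColumn, [:: blocks ws; [::]; [::]; [::]; nseq n (Some true)]).
  have := load_count (nseq n true) (blocks ws) [::].
  by rewrite map_nseq size_nseq catrevE cats0 rev_nseq.
set out := blocks (pad n ws').
have szout : size out <= M * (n + n).+1.
  rewrite (@size_blocks (n + n)).
    by rewrite leq_mul2r /pad size_map size_filter -eqM count_size orbT.
  rewrite all_map all_filter; apply: sub_all szws' => w /eqP szw /=.
  by rewrite size_cat size_nseq szw eqxx implybT.
have filter_run : reach (M * (3 * n.+1)).+2
    (NextColumn, [:: blocks ws'; [::]; [::]; [::]; [::]])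
    (RewindOutput, [:: [::]; catrev out [::]; [::]; [::]; [::]]).
  by machine_step; rewrite -eqM; apply: filter_tails.
have rewind_run : reach (M * (n + n).+1)
    (RewindOutput, [:: [::]; catrev out [::]; [::]; [::]; [::]])
    (RewindOutput, [:: out; [::]; [::]; [::]; [::]]).
  apply: (reaches_weaken szout).
  have := rewind_output (catrev out [::]) [::].
  by rewrite !catrevE !cats0 revK size_rev.
have := reaches_trans load (reaches_trans column_run
          (reaches_trans filter_run rewind_run)).
move/stack_tm_outputs; apply=> //.
(* Twice the sum of the four bounds has leading term [12 * n ^ 2 * M], so the factor 100 is
   ample. *)
rewrite -mul2n expnS expnS expn1.
case: n {szws ws' szws' eqM column_run load out szout filter_run rewind_run} => [|n] /=.
  nia.
nia.
Qed.

Local Open Scope ring_scope.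

(** * Linear algebra over F_2 *)

Lemma F2_cases (a : 'F_2) : a = 0 \/ a = 1.
Proof. by case: a => [[|[|?]] ?] //; [left|right]; apply: val_inj. Qed.

Lemma F2_addb (a b : 'F_2) : (a + b != 0) = (a != 0) (+) (b != 0).
Proof. by case: (F2_cases a) => ->; case: (F2_cases b) => ->. Qed.

(** Coefficients are 0 or 1, so a linear combination is a plain sum of members of [L] and scaling
    needs no case. *)
Lemma F2_span_ind (V : vectType 'F_2) (L : seq V) (P : V -> Prop) :
  P 0 -> (forall u v, u \in L -> P v -> P (u + v)) ->
  forall v, v \in <<L>>%VS -> P v.
Proof.
move=> P0 PD v; rewrite -[L]/(tval (in_tuple L)) => /coord_span->.
apply: big_rec => //= i u _ Pu; case: (F2_cases (coord (in_tuple L) i v)) => ->.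
  by rewrite scale0r add0r.
by rewrite scale1r; apply: PD => //; apply: mem_nth.
Qed.

Lemma F2_addvv (V : lmodType 'F_2) (v : V) : v + v = 0.
Proof. by rewrite -mulr2n -scaler_nat (_ : 2%:R = 0 :> 'F_2) ?scale0r //; apply: val_inj. Qed.

Lemma span_filter_neq0 (K : fieldType) (V : vectType K) (L : seq V) :
  <<[seq v : V <- L | v != 0%R]>>%VS = <<L>>%VS.
Proof.
apply/eqP; rewrite eqEsubv; apply/andP; split.
  exact/sub_span/mem_subseq/filter_subseq.
apply/span_subvP => v vL; have [->|vN0] := eqVneq v 0; first exact: mem0v.
by rewrite memv_span // mem_filter vN0.
Qed.

(** * Elimination on words as linear algebra on labels *)

Section Words.
Variable n : nat.
Implicit Types (u v p : label n) (L : seq (label n)).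

Definition vector_word (x : 'rV['F_2]_n) : seq bool := [seq x 0 j != 0 | j <- enum 'I_n].

Definition label_word v : seq bool := vector_word v.1 ++ vector_word v.2.

Lemma size_vector_word x : size (vector_word x) = n.
Proof. by rewrite size_map size_enum_ord. Qed.

Lemma size_label_word v : size (label_word v) = (n + n)%N.
Proof. by rewrite size_cat !size_vector_word. Qed.

Lemma encode_labelsE L :
  encode_labels L = map tape_symbol (blocks (map label_word L)).
Proof.
rewrite /encode_labels /blocks map_flatten -!map_comp; congr flatten.
apply: eq_map => v /=; rewrite map_rcons -cats1 map_cat map_cat -catA /encode_vector.
by rewrite -!map_comp.
Qed.

Lemma xor_word_cat s t s' t' : size s = size t ->
  xor_word (s ++ s') (t ++ t') = xor_word s t ++ xor_word s' t'.
Proof. by move=> eq_sz; rewrite /xor_word zip_cat // map_cat. Qed.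

Lemma drop_xor_word k s t : drop k (xor_word s t) = xor_word (drop k s) (drop k t).
Proof. by elim: k s t => [|k IH] [|x s] [|y t] //=; rewrite ?IH // /xor_word; case: (drop _ _). Qed.

Lemma vector_wordD x y :
  vector_word (x + y) = xor_word (vector_word x) (vector_word y).
Proof.
rewrite /vector_word /xor_word; elim: (enum _) => //= j s ->.
by rewrite mxE F2_addb.
Qed.

Lemma label_wordD u v : label_word (u + v) = xor_word (label_word u) (label_word v).
Proof. by rewrite xor_word_cat ?size_vector_word // -!vector_wordD. Qed.

Lemma drop_label_word (j : 'I_n) v :
  drop j (label_word v) = (v.1 0 j != 0) :: drop j.+1 (label_word v).
Proof.
rewrite (drop_nth false) ?size_label_word ?ltn_addr //; congr cons.
rewrite nth_cat size_vector_word ltn_ord (nth_map j) ?size_enum_ord //.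
by rewrite nth_ord_enum.
Qed.

(** For [p] with x coordinate 1 at [j], the projection along [p] onto the hyperplane where that
    coordinate vanishes; for [p = 0], the identity. *)
Definition clear_coordinate (j : 'I_n) p v : label n := v + v.1 0 j *: p.

Lemma clear_coordinateD j p u v :
  clear_coordinate j p (u + v) = clear_coordinate j p u + clear_coordinate j p v.
Proof. by rewrite /clear_coordinate mxE scalerDl addrACA. Qed.

(* The bits left of each label once [k] columns have been dropped. *)
Definition tails k L := [seq drop k (label_word v) | v <- L].

Lemma eliminate_pivot (j : 'I_n) p L : p.1 0 j != 0 ->
  eliminate (drop j.+1 (label_word p)) (tails j L) =
  tails j.+1 (map (clear_coordinate j p) L).
Proof.
move=> pj; elim: L => //= v L IH; rewrite drop_label_word /clear_coordinate.
case: (F2_cases (v.1 0 j)) => -> /=; first by rewrite scale0r addr0 IH.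
(* Since [j < n], the whole z part remains and is nonempty, so the pivot is recognised as such. *)
have /negPf-> : ~~ nilp (drop j.+1 (label_word p)).
  by rewrite /nilp size_drop size_label_word; have := ltn_ord j; lia.
by rewrite IH scale1r label_wordD drop_xor_word.
Qed.

(** The witness is the first vector with x coordinate 1 at [j], or 0 if there is none. Vectors
    before the pivot have coordinate 0, so clearing with [p] leaves them alone, just as the machine
    does. *)
Lemma eliminate_tails (j : 'I_n) L :
  exists2 p : label n,
    eliminate [::] (tails j L) = tails j.+1 (map (clear_coordinate j p) L) &
    p.1 0 j = 1 /\ p \in L \/ p = 0 /\ (forall v, v \in L -> v.1 0 j = 0).
Proof.
elim: L => [|v L [p IH piv]]; first by exists 0 => //; right.
rewrite /= drop_label_word; case: (F2_cases (v.1 0 j)) => vj.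
  exists p; last first.
    case: piv => [[pj pL]|[p0 L0]]; [left|right]; split=> //.
      by rewrite inE pL orbT.
    by move=> u; rewrite inE => /orP[/eqP-> //|/L0].
  by rewrite /clear_coordinate vj /= IH scale0r addr0.
exists v; last by left; rewrite mem_head.
rewrite vj /= eliminate_pivot ?vj // /clear_coordinate vj scale1r F2_addvv.
congr cons; rewrite -drop_xor_word -label_wordD F2_addvv.
by [].
Qed.

(** Clearing is additive, changes a vector only by a multiple of [p], which lies in the span, and
    fixes every vector whose coordinate is already 0. *)
Lemma span_clear_coordinate (j : 'I_n) p L :
  p.1 0 j = 1 /\ p \in L \/ p = 0 /\ (forall v, v \in L -> v.1 0 j = 0) ->
  forall v, v \in <<map (clear_coordinate j p) L>>%VS <->
            v \in <<L>>%VS /\ v.1 0 j = 0.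
Proof.
move=> piv v.
have pL : p \in <<L>>%VS.
  by case: piv => [[_ /memv_span //]|[-> _]]; apply: mem0v.
have clear0 u : u \in <<L>>%VS -> (clear_coordinate j p u).1 0 j = 0.
  move=> uL; rewrite /clear_coordinate !mxE; case: piv => [[pj _]|[-> L0]].
    by rewrite pj mulr1 (@F2_addvv ('F_2)^o).
  rewrite mxE mulr0 addr0; move: u uL; apply: F2_span_ind; first by rewrite mxE.
  by move=> u w /L0 u0 w0; rewrite mxE u0 w0 addr0.
split; last first.
  case=> vL vj; rewrite -[v](_ : clear_coordinate j p v = v); last first.
    by rewrite /clear_coordinate vj scale0r addr0.
  move: {vj} v vL; apply: F2_span_ind.
    by rewrite /clear_coordinate mxE scale0r addr0 mem0v.
  by move=> u w uL wL; rewrite clear_coordinateD memvD // memv_span // map_f.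
move: v; apply: F2_span_ind; first by rewrite mem0v mxE.
move=> _ w /mapP[u /memv_span uL ->] [wL wj]; split; last first.
  by rewrite mxE clear0 // add0r.
by rewrite memvD // memvD // memvZ.
Qed.

Lemma iter_eliminate_tails k L : (k <= n)%N ->
  exists2 L' : seq (label n),
    iter k (eliminate [::]) (map label_word L) = tails k L' &
    forall v, v \in <<L'>>%VS <->
      v \in <<L>>%VS /\ (forall j : 'I_n, (j < k)%N -> v.1 0 j = 0).
Proof.
elim: k => [_|k IH ltk].
  exists L; first by apply: eq_map => v; rewrite drop0.
  by move=> v; split=> [|[]].
have [L' E spanL'] := IH (ltnW ltk).
have [p Ep /span_clear_coordinate span_p] := eliminate_tails (Ordinal ltk) L'.
exists (map (clear_coordinate (Ordinal ltk) p) L'); first by rewrite iterS E Ep.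
move=> v; rewrite span_p spanL'; split.
  case=> -[vL v0] vk; split=> // j; rewrite ltnS leq_eqVlt => /orP[/eqP jk|/v0 //].
  by rewrite -vk; congr (v.1 0 _); apply: val_inj.
case=> vL v0; split; last by apply: v0 => /=.
by split=> // j ltj; apply: v0; rewrite ltnS ltnW.
Qed.

Lemma vector_word0 : vector_word 0 = nseq n false.
Proof.
rewrite /vector_word -[in RHS](size_enum_ord n).
by elim: (enum _) => //= j s ->; rewrite mxE.
Qed.

Lemma has_vector_word x : has id (vector_word x) = (x != 0).
Proof.
apply/idP/idP => [|xN0]; last first.
  apply: contraR xN0 => /hasPn x0; apply/eqP/rowP => j; rewrite mxE; apply/eqP.
  apply: contraT => xj.
  by have := x0 _ (map_f (fun i => x 0 i != 0) (mem_enum (mem predT) j)); rewrite xj.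
by apply: contraTN => /eqP->; rewrite vector_word0 has_nseq andbF.
Qed.

(** The [n] dropped bits were all zero, so padding restores them, and such a label vanishes exactly
    when its z part does. *)
Lemma pad_tails L : (forall v, v \in L -> v.1 = 0) ->
  pad n (tails n L) = map label_word [seq v <- L | v != 0].
Proof.
elim: L => //= v L IH L0; have v0 : v.1 = 0 by apply: L0; rewrite mem_head.
have dropv : drop n (label_word v) = vector_word v.2.
  by rewrite -{1}(size_vector_word v.1) drop_size_cat.
rewrite /pad /= dropv has_vector_word.
have -> : (v != 0) = (v.2 != 0).
  by case: v v0 {L0 dropv} => x z /= ->; rewrite xpair_eqE eqxx.
have {}IH := IH (fun u uL => L0 u (mem_behead (s := v :: L) uL)).
rewrite /pad in IH; case: ifP => _ //=; rewrite {}IH //.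
by rewrite /label_word v0 vector_word0.
Qed.

Lemma eliminated_span L : exists2 gens : seq (label n),
  pad n (iter n (eliminate [::]) (map label_word L)) = map label_word gens &
  0 \notin gens /\ (forall v, v \in <<gens>>%VS <-> v \in <<L>>%VS /\ v.1 = 0).
Proof.
have [L' E spanL'] := iter_eliminate_tails L (leqnn n).
have rowE v : (forall j : 'I_n, (j < n)%N -> v.1 0 j = 0) <-> v.1 = 0.
  split=> [v0|-> j _]; last by rewrite mxE.
  by apply/rowP => j; rewrite v0 ?mxE.
exists [seq v <- L' | v != 0].
  by rewrite E pad_tails // => v /memv_span /spanL'[_ /rowE].
split; first by rewrite mem_filter eqxx.
by move=> v; rewrite span_filter_neq0 spanL' rowE.
Qed.

End Words.

Lemma encode_inputE n (L : seq (label n)) : encode_input L =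
  map tape_symbol (nseq n (Some true) ++ None :: blocks (map (@label_word n) L)).
Proof. by rewrite /encode_input encode_labelsE map_cat map_nseq. Qed.

(** * The Pauli group *)

Section Tensor.
Variable R : realType.
Local Notation C := R[i].

Lemma eq_tensor n (A B : 'I_n -> 'M[C]_2) : A =1 B -> tensor A = tensor B.
Proof.
elim: n A B => //= n IH A B eqAB; rewrite eqAB; congr (castmx _ (_ *t _)).
by apply: IH => j; rewrite eqAB.
Qed.

Lemma castmx_sqM m m' (e : m = m') (A B : 'M[C]_m) :
  castmx (e, e) A *m castmx (e, e) B = castmx (e, e) (A *m B).
Proof. by case: m' / e; rewrite !castmx_id. Qed.

Lemma castmxZ m m' (e : m = m') a (A : 'M[C]_m) :
  castmx (e, e) (a *: A) = a *: castmx (e, e) A.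
Proof. by case: m' / e; rewrite !castmx_id. Qed.

Lemma castmx_sq1 m m' (e : m = m') : castmx (e, e) 1%:M = 1%:M :> 'M[C]_m'.
Proof. by case: m' / e; rewrite castmx_id. Qed.

Lemma mxtrace_castmx m m' (e : m = m') (A : 'M[C]_m) : \tr (castmx (e, e) A) = \tr A.
Proof. by case: m' / e; rewrite castmx_id. Qed.

Lemma tensmxZ m n a b (A : 'M[C]_m) (B : 'M[C]_n) :
  (a *: A) *t (b *: B) = (a * b) *: (A *t B).
Proof.
apply/matrixP => i j; case: (mxtens_indexP i) => i1 i2; case: (mxtens_indexP j) => j1 j2.
by rewrite tensmxE [RHS]mxE tensmxE !mxE mulrACA.
Qed.

Lemma tensmx11 m n : (1%:M : 'M[C]_m) *t (1%:M : 'M[C]_n) = 1%:M.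
Proof.
apply/matrixP => i j; case: (mxtens_indexP i) => i1 i2; case: (mxtens_indexP j) => j1 j2.
by rewrite tensmxE !mxE (can_eq (@mxtens_indexK m n)) xpair_eqE -natrM mulnb.
Qed.

Lemma mxtrace_tensmx m n (A : 'M[C]_m) (B : 'M[C]_n) : \tr (A *t B) = \tr A * \tr B.
Proof.
rewrite /mxtrace mulr_sum; apply: eq_bigr => i _.
by case: (mxtens_indexP i) => i1 i2; rewrite tensmxE mxtens_indexK.
Qed.

Lemma tensorM n (A B : 'I_n -> 'M[C]_2) :
  tensor A *m tensor B = tensor (fun j => A j *m B j).
Proof.
elim: n A B => /= [|n IH] A B; first by rewrite mul1mx.
by rewrite castmx_sqM tensmx_mul IH.
Qed.

Lemma tensorZ n (a : 'I_n -> C) (A : 'I_n -> 'M[C]_2) :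
  tensor (fun j => a j *: A j) = (\prod_j a j) *: tensor A.
Proof.
elim: n a A => /= [|n IH] a A; first by rewrite big_ord0 scale1r.
by rewrite IH tensmxZ castmxZ big_ord_recl.
Qed.

Lemma tensor1 n : tensor (fun _ : 'I_n => 1%:M) = 1%:M :> 'M[C]_(2 ^ n).
Proof. by elim: n => //= n ->; rewrite tensmx11 castmx_sq1. Qed.

Lemma trmx_tensor n (A : 'I_n -> 'M[C]_2) : (tensor A)^T = tensor (fun j => (A j)^T).
Proof.
elim: n A => /= [|n IH] A; first by rewrite trmx1.
by rewrite trmx_cast trmx_tens IH.
Qed.

Lemma mxtrace_tensor n (A : 'I_n -> 'M[C]_2) : \tr (tensor A) = \prod_j \tr (A j).
Proof.
elim: n A => /= [|n IH] A; first by rewrite big_ord0 mxtrace1.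
by rewrite mxtrace_castmx mxtrace_tensmx IH big_ord_recl.
Qed.

End Tensor.

(** * Pauli strings, their products and traces *)

Section Pauli.
Variable R : realType.
Local Notation C := R[i].
Local Notation X := (pauliX R).
Local Notation Z := (pauliZ R).

Lemma pauliX2 : X *m X = 1%:M.
Proof.
by apply/matrixP; do 2![case=> [[|[|//]] ?]]; rewrite !mxE !big_ord_recl big_ord0 !mxE /=;
  rewrite ?(mulr0, mul0r, mul1r, addr0, add0r).
Qed.

Lemma pauliZ2 : Z *m Z = 1%:M.
Proof.
by apply/matrixP; do 2![case=> [[|[|//]] ?]]; rewrite !mxE !big_ord_recl big_ord0 !mxE /=;
  rewrite ?(mulr0, mul0r, mul1r, addr0, add0r, expr0, expr1, mulrNN).
Qed.

Lemma pauliZX : Z *m X = - (X *m Z).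
Proof.
by apply/matrixP; do 2![case=> [[|[|//]] ?]]; rewrite !mxE !big_ord_recl !big_ord0 !mxE /=;
  rewrite ?(mulr0, mul0r, mul1r, mulr1, addr0, add0r, expr0, expr1, oppr0, opprK).
Qed.

Lemma trmx_pauliX : X^T = X.
Proof. by apply/matrixP => i j; rewrite !mxE eq_sym. Qed.

Lemma trmx_pauliZ : Z^T = Z.
Proof.
by apply/matrixP => i j; rewrite !mxE eq_sym; case: eqVneq => [->|]; rewrite ?mul0r.
Qed.

(** The Pauli matrix without its power of [i]; products of these produce signs only. *)
Definition pauliXZ (x z : 'F_2) : 'M[C]_2 := X ^+ x *m Z ^+ z.

Lemma pauliXZ_mul x z x' z' : exists b : bool,
  pauliXZ x z *m pauliXZ x' z' = (-1) ^+ b *: pauliXZ (x + x') (z + z').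
Proof.
have F2_11 : 1 + 1 = 0 :> 'F_2 by apply: val_inj.
(* A sign arises exactly when a [Z] has to pass an [X]. *)
exists ((z != 0) && (x' != 0)); rewrite /pauliXZ.
case: (F2_cases x) => ->; case: (F2_cases z) => ->;
  case: (F2_cases x') => ->; case: (F2_cases z') => ->;
  rewrite ?F2_11 ?addr0 ?add0r /= !(expr0, expr1) ?(mul1mx, mulmx1, scale1r);
  rewrite ?mulmxA ?pauliX2 ?pauliZ2 ?mul1mx //.
- by rewrite pauliZX scaleN1r.
- by rewrite pauliZX mulNmx -mulmxA pauliZ2 mulmx1 scaleN1r.
- by rewrite -mulmxA pauliZ2 mulmx1.
- by rewrite -mulmxA pauliZX mulmxN mulmxA pauliX2 mul1mx scaleN1r.
- by rewrite -(mulmxA X) pauliZX mulmxN mulmxA pauliX2 mul1mx mulNmx pauliZ2 scaleN1r.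
Qed.

Lemma mxtrace_pauliXZ x z : \tr (pauliXZ x z) = ((x == 0) && (z == 0))%:R *+ 2.
Proof.
have trZ : \tr Z = 0.
  by rewrite /mxtrace !big_ord_recl big_ord0 !mxE /= expr0 expr1 !mul1r addr0 subrr.
have trX : \tr X = 0 by rewrite /mxtrace !big_ord_recl big_ord0 !mxE /= !addr0.
have trXZ : \tr (X *m Z) = 0.
  rewrite /mxtrace !big_ord_recl big_ord0 !mxE !big_ord_recl !big_ord0 !mxE /=.
  by rewrite !(mulr0, mul0r, addr0).
case: (F2_cases x) => ->; case: (F2_cases z) => ->; rewrite /pauliXZ /=
  ?expr0 ?expr1 ?mul1mx ?mulmx1 ?mul0rn //.
exact: mxtrace1.
Qed.

Lemma trmx_pauliXZ x z : (pauliXZ x z)^T = (-1) ^+ (x * z)%N *: pauliXZ x z.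
Proof.
case: (F2_cases x) => ->; case: (F2_cases z) => ->; rewrite /pauliXZ trmx_mul /=
  ?(expr0, expr1) ?trmx1 ?trmx_pauliX ?trmx_pauliZ ?mul1mx ?mulmx1 ?scale1r //.
by rewrite pauliZX scaleN1r.
Qed.

Section Strings.
Variable n : nat.
Implicit Types v w : label n.

Definition pauliXZ_string v : 'M[C]_(2 ^ n) :=
  tensor (fun j => pauliXZ (v.1 0 j) (v.2 0 j)).

(** A natural number and not a residue mod 2, because it serves as an exponent of [i], which has
    order 4. *)
Definition pauliY_count v : nat := (\sum_j v.1 0%R j * v.2 0%R j)%N.

Lemma pauliE v : pauli R v = 'i%C ^+ pauliY_count v *: pauliXZ_string v.
Proof. by rewrite /pauli tensorZ -expr_sum. Qed.

Lemma pauliXZ_stringM v w : exists b : bool,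
  pauliXZ_string v *m pauliXZ_string w = (-1) ^+ b *: pauliXZ_string (v + w).
Proof.
have /fin_all_exists[b bE] j := pauliXZ_mul (v.1 0 j) (v.2 0 j) (w.1 0 j) (w.2 0 j).
exists (odd (\sum_j b j)).
rewrite tensorM (eq_tensor bE) tensorZ -expr_sum signr_odd; congr (_ *: _).
by apply: eq_tensor => j; rewrite !mxE.
Qed.

Lemma mxtrace_pauliXZ_string v : \tr (pauliXZ_string v) = (v == 0)%:R *+ (2 ^ n).
Proof.
rewrite mxtrace_tensor; case: eqVneq => [->|vN0].
  rewrite (eq_bigr (fun _ => 2%:R)) => [|j _]; last by rewrite mxtrace_pauliXZ !mxE eqxx.
  by rewrite prodr_const card_ord natrX.
apply/eqP; rewrite mul0rn; apply: contraNT vN0 => /prodf_neq0 trN0.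
have {}trN0 j : (v.1 0 j == 0) && (v.2 0 j == 0).
  by have := trN0 j isT; rewrite mxtrace_pauliXZ; case: (_ && _) => //; rewrite mul0rn eqxx.
case: v trN0 => x z /= trN0; rewrite xpair_eqE; apply/andP.
by split; apply/eqP/rowP => j; rewrite mxE; case/andP: (trN0 j) => /eqP v1 /eqP v2.
Qed.

Lemma trmx_pauli v : (pauli R v)^T = (-1) ^+ pauliY_count v *: pauli R v.
Proof.
rewrite pauliE linearZ /= scalerA mulrC -scalerA; congr (_ *: _).
rewrite trmx_tensor expr_sum -tensorZ; apply: eq_tensor => j; exact: trmx_pauliXZ.
Qed.

Lemma pauliXZ_string0 : pauliXZ_string 0 = 1%:M.
Proof.
rewrite -(tensor1 R n); apply: eq_tensor => j; rewrite /pauliXZ !mxE.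
by rewrite !expr0 mulmx1.
Qed.

Lemma F2_addv_eq0 v w : (v + w == 0) = (v == w).
Proof. by rewrite -(inj_eq (addIr w)) -addrA F2_addvv addr0 add0r. Qed.

(** Trace orthogonality: the product is, up to sign, the string of [v + w], which is traceless
    unless [v + w = 0]. *)
Lemma mxtrace_pauliXZ_stringM v w :
  (\tr (pauliXZ_string v *m pauliXZ_string w) == 0) = (v != w).
Proof.
have [b ->] := pauliXZ_stringM v w.
rewrite mxtraceZ mulf_eq0 signr_eq0 /= mxtrace_pauliXZ_string F2_addv_eq0.
case: (v == w); last by rewrite mul0rn eqxx.
by rewrite pnatr_eq0 expn_eq0.
Qed.

(** After multiplication by the string of [v], the left side has nonzero trace, and the right side
    too only if [v = w]. *)
Lemma signed_pauliXZ_string_inj (b d : bool) v w :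
  (-1) ^+ b *: pauliXZ_string v = (-1) ^+ d *: pauliXZ_string w -> v = w.
Proof.
move/(congr1 (mulmx (pauliXZ_string v))) => /(congr1 mxtrace)/eqP.
rewrite -!scalemxAr !mxtraceZ => eq_tr; apply/eqP/negPn/negP.
rewrite -mxtrace_pauliXZ_stringM => /eqP tr0; move: eq_tr.
by rewrite tr0 mulr0 mulf_eq0 signr_eq0 mxtrace_pauliXZ_stringM eqxx.
Qed.

Lemma pauli_free (d : label n -> C) :
  \sum_v d v *: pauli R v = 0 -> forall v, d v = 0.
Proof.
move=> sum0 w; have : \tr ((\sum_v d v *: pauli R v) *m pauliXZ_string w) = 0.
  by rewrite sum0 mul0mx mxtrace0.
rewrite mulmx_suml raddf_sum (bigD1 w) //= big1 => [|v neq_vw]; last first.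
  rewrite pauliE scalerA -scalemxAl mxtraceZ.
  by rewrite (eqP (_ : \tr (_ *m _) == 0)) ?mulr0 // mxtrace_pauliXZ_stringM.
rewrite addr0 pauliE scalerA -scalemxAl mxtraceZ => /eqP.
rewrite mulf_eq0 mxtrace_pauliXZ_stringM eqxx orbF mulf_eq0 expf_eq0.
have /negPf-> : 'i%C != 0 :> C by rewrite eq_complex /= oner_eq0 andbF.
by rewrite andbF orbF => /eqP.
Qed.

End Strings.

(** * The diagonal group as a subspace of the span of the labels *)

Section DiagonalGroup.
Variables (n : nat) (A : 'M[R]_(2 ^ n)) (c : label n -> C) (L : seq (label n)).
Hypotheses (symA : A^T = A) (expA : pauli_expansion A c).
Hypothesis memL : forall v, (v \in L) = (c v != 0).

Lemma pauliY_count_even v : v \in L -> ~~ odd (pauliY_count v).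
Proof.
rewrite memL; apply: contraNN => oddv.
(* This is the expansion of [A - A^T]; at a label with an odd count its coefficient is twice
   [c v]. *)
have free : \sum_v (c v - (-1) ^+ pauliY_count v * c v) *: pauli R v = 0.
  rewrite (eq_bigr (fun v => c v *: pauli R v - (c v *: pauli R v)^T)) => [|w _].
    rewrite sumrB -(raddf_sum (@trmx C _ _)) -expA; apply/eqP; rewrite subr_eq0; apply/eqP.
    by apply/matrixP => i j; rewrite !mxE -[in LHS]symA mxE.
  by rewrite [(_ *: _)^T]linearZ /= trmx_pauli scalerA scalerBl [c w * _]mulrC.
have /eqP := pauli_free free v.
by rewrite -signr_odd oddv expr1 mulN1r opprK -mulr2n mulrn_eq0.
Qed.

Lemma pauli_signed v : v \in L -> exists b : bool, pauli R v = (-1) ^+ b *: pauliXZ_string v.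
Proof.
move/pauliY_count_even => evenv; exists (odd (pauliY_count v)./2).
rewrite pauliE -{1}[pauliY_count v]odd_double_half (negPf evenv) add0n -mul2n exprM.
by rewrite sqr_i signr_odd.
Qed.

(** Signed real strings with labels in the span contain the generators and are closed under products
    and inverses. *)
Lemma pauli_group_span M : pauli_group_of c M ->
  exists2 v, v \in <<L>>%VS & exists b : bool, M = (-1) ^+ b *: pauliXZ_string v.
Proof.
elim=> {M} [M [v cv ->]||M N _ [v vL [b ->]] _ [w wL [d ->]]|M _ [v vL [b ->]]].
- have vL : v \in L by rewrite memL.
  by exists v; [apply: memv_span | apply: pauli_signed].
- by exists 0; [apply: mem0v | exists false; rewrite scale1r pauliXZ_string0].
- exists (v + w); first exact: memvD.
  have [e vwE] := pauliXZ_stringM v w; exists (b (+) d (+) e).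
  by rewrite -scalemxAl -scalemxAr vwE !scalerA !signr_addb.
- exists v => //; have [e] := pauliXZ_stringM v v.
  (* A real string squares to [(-1) ^+ e], so it is its own inverse up to that sign. *)
  rewrite F2_addvv pauliXZ_string0 => vvE; exists (e (+) b).
  have inv : ((-1) ^+ b *: pauliXZ_string v) *m ((-1) ^+ (e (+) b) *: pauliXZ_string v) = 1%:M.
    rewrite -scalemxAl -scalemxAr vvE !scalerA -!signr_addb.
    by rewrite addbCA addbb addbF addbb scale1r.
  have [unitM _] := mulmx1_unit inv.
  by rewrite -[LHS]mulmx1 -inv mulKmx.
Qed.

Lemma span_pauli_group v : v \in <<L>>%VS ->
  exists b : bool, pauli_group_of c ((-1) ^+ b *: pauliXZ_string v).
Proof.
move: v; apply: F2_span_ind.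
  by exists false; rewrite scale1r pauliXZ_string0; apply: gen_one.
move=> v w vL [b wG]; have [d vE] := pauli_signed vL.
have [e vwE] := pauliXZ_stringM v w.
exists (d (+) b (+) e).
have vG : pauli_group_of c (pauli R v) by apply: gen_mem; exists v; rewrite -?memL.
have := gen_mul vG wG.
by rewrite vE -scalemxAl -scalemxAr vwE !scalerA !signr_addb.
Qed.

Lemma pauli_diag_label (B : {set 'I_n}) :
  pauli R (diag_label B) = pauliXZ_string (diag_label B).
Proof.
rewrite pauliE /pauliY_count big1 ?scale1r // => j _.
by rewrite mxE.
Qed.

Lemma diagonal_groupE (B : {set 'I_n}) :
  diagonal_group c B <-> diag_label B \in <<L>>%VS.
Proof.
rewrite /diagonal_group pauli_diag_label; split; last first.
  move=> /span_pauli_group[[]]; first by rewrite scaleN1r; right.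
  by rewrite scale1r; left.
(* The two cases are the signs allowed in [diagonal_group]; either way the signed string determines
   its label. *)
case=> /pauli_group_span[v vL [b E]].
  have -> // : diag_label B = v.
  by apply: (@signed_pauliXZ_string_inj _ false b); rewrite -E scale1r.
have -> // : diag_label B = v.
by apply: (@signed_pauliXZ_string_inj _ true b); rewrite -E scaleN1r.
Qed.

Lemma nontrivial_diagonalE (B : {set 'I_n}) :
  diag_label B != 0 -> diagonal_group c B -> nontrivial_diagonal c B.
Proof.
move=> BN0 BD; split=> //; rewrite pauli_diag_label => B1.
have := mxtrace_pauliXZ_stringM (diag_label B) 0.
by rewrite BN0 pauliXZ_string0 mulmx1 B1 mxtrace1 pnatr_eq0 expn_eq0.
Qed.

End DiagonalGroup.
End Pauli.

(** * The algorithm outputs generators of the diagonal group *)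

Lemma diag_labelP n (v : label n) : v.1 = 0 -> exists A, v = diag_label A.
Proof.
case: v => x z /= ->; exists [set j | z 0 j != 0]; congr pair.
by apply/rowP => j; rewrite mxE inE; case: (F2_cases (z 0 j)) => ->.
Qed.

Theorem proposition15 :
  exists (T : turing_machine) (a d : nat),
  forall (R : realType) (n : nat) (C : 'M[R]_(2 ^ n))
         (c : label n -> R[i]) (L : seq (label n)),
    C^T = C ->
    pauli_expansion C c ->
    uniq L ->
    (forall v : label n, (v \in L) = (c v != 0)) ->
    exists gens : seq (label n),
      outputs_within T (encode_input L) (a * (size L + n + 1) ^ d)%N
        (encode_labels gens)
      /\ generates_diagonal c gens.
Proof.
exists diagonal_tm, 100%N, 3%N => R n C c L symC expC _ memL.
have [gens padE [gensN0 spanG]] := eliminated_span L.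
have diagE v : v \in <<gens>>%VS <-> exists2 A, diagonal_group c A & v = diag_label A.
  rewrite spanG; split=> [[vL /diag_labelP[A vA]]|[A AD ->]].
    by exists A => //; apply/(diagonal_groupE symC expC memL); rewrite -vA.
  by split=> //; apply/(diagonal_groupE symC expC memL).
exists gens; split.
  rewrite encode_inputE encode_labelsE -padE -(size_map (@label_word n)).
  apply: diagonal_tm_outputs; rewrite all_map; apply/allP => v _ /=.
  by rewrite size_label_word.
split=> [g gG|//].
have [A AD gA] := (diagE g).1 (memv_span gG); exists A => //.
(* Zero vectors were filtered from the output, so no generator is the identity string. *)
by apply: nontrivial_diagonalE; rewrite // -gA; apply: contraNneq gensN0 => <-.
Qed.
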